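(* Let $k$ be any field, let $g\in k[[t]]$ be a power series such that $g(0)=0$ and $\frac{dg}{dt}\notin k(t,g)$, and let $V_g=k(t,g)\cap k[[t]]$, a discrete valuation ring and $k$-algebra. Then $V_g$ does not admit any nontrivial (i.e. nonzero) $k$-linear derivation $V_g\to V_g$.
   Context: $k(t,g)$ denotes the subfield of $k((t))=k[[t]][\frac1t]$ generated over $k$ by $t$ and $g$; the intersection is taken in $k((t))$, and $\frac{d}{dt}$ is the formal derivative. *)

(* Defs.v *)
From HB Require Import structures.
From mathcomp Require Import all_boot all_order all_algebra.
From mathcomp Require Import boolp.

Set Implicit Arguments.
Unset Strict Implicit.
Unset Printing Implicit Defensive.

Import GRing.Theory.
Local Open Scope ring_scope.

(** The ring k[[t]].  A wrapper around [nat -> k] is needed because functions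
    already carry the pointwise ring structure. *)

Record fps (k : fieldType) := Fps { coeff : nat -> k }.

HB.instance Definition _ (k : fieldType) := gen_eqMixin (fps k).
HB.instance Definition _ (k : fieldType) := gen_choiceMixin (fps k).

Section PowerSeries.
Variable k : fieldType.
Implicit Types f g h : fps k.

Lemma fpsP f g : (forall n, coeff f n = coeff g n) <-> f = g.
Proof.
split=> [|-> //]; case: f g => [f] [g] /= fg; congr Fps.
exact: functional_extensionality_dep.
Qed.

Definition fps_zero : fps k := Fps (fun=> 0).
Definition fps_opp f : fps k := Fps (fun n => - coeff f n).
Definition fps_add f g : fps k := Fps (fun n => coeff f n + coeff g n).
Definition fps_one : fps k := Fps (fun n => (n == 0)%:R).
Definition fps_mul f g : fps k :=
  Fps (fun n => \sum_(i < n.+1) coeff f i * coeff g (n - i)).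
Definition fps_scale (c : k) f : fps k := Fps (fun n => c * coeff f n).

Fact fps_addA : associative fps_add.
Proof. by move=> f g h; apply/fpsP => n /=; rewrite addrA. Qed.
Fact fps_addC : commutative fps_add.
Proof. by move=> f g; apply/fpsP => n /=; rewrite addrC. Qed.
Fact fps_add0 : left_id fps_zero fps_add.
Proof. by move=> f; apply/fpsP => n /=; rewrite add0r. Qed.
Fact fps_addN : left_inverse fps_zero fps_opp fps_add.
Proof. by move=> f; apply/fpsP => n /=; rewrite addNr. Qed.

HB.instance Definition _ :=
  GRing.isZmodule.Build (fps k) fps_addA fps_addC fps_add0 fps_addN.

(* The ring axioms are transported from polynomials by truncation. *)
Let trunc n f : {poly k} := \poly_(i < n.+1) coeff f i.

Let coef_trunc n f i : (i <= n)%N -> (trunc n f)`_i = coeff f i.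
Proof. by move=> le_in; rewrite coef_poly ltnS le_in. Qed.

Let coeff_mul n f g i : (i <= n)%N ->
  coeff (fps_mul f g) i = (trunc n f * trunc n g)`_i.
Proof.
move=> le_in; rewrite coefM /=; apply: eq_bigr => -[j /=]; rewrite ltnS => le_ji _.
by rewrite !coef_trunc ?(leq_trans _ le_in) ?leq_subr.
Qed.

Let coefM_eq (p q p' q' : {poly k}) n :
    (forall i, (i <= n)%N -> p`_i = p'`_i) ->
    (forall i, (i <= n)%N -> q`_i = q'`_i) ->
  (p * q)`_n = (p' * q')`_n.
Proof.
move=> pp' qq'; rewrite !coefM; apply: eq_bigr => -[j /=]; rewrite ltnS => le_jn _.
by rewrite pp' // qq' ?leq_subr.
Qed.

Fact fps_mulC : commutative fps_mul.
Proof. by move=> f g; apply/fpsP => n; rewrite !(@coeff_mul n) // mulrC. Qed.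

Fact fps_mulA : associative fps_mul.
Proof.
move=> f g h; apply/fpsP => n; rewrite !(@coeff_mul n) //.
rewrite -(@coefM_eq (trunc n f) (trunc n g * trunc n h)) //; last first.
  by move=> i le_in; rewrite coef_trunc // (coeff_mul _ _ le_in).
rewrite mulrA; apply: coefM_eq => // i le_in.
by rewrite coef_trunc // (coeff_mul _ _ le_in).
Qed.

Fact fps_mul1 : left_id fps_one fps_mul.
Proof.
move=> f; apply/fpsP => n /=; rewrite big_ord_recl /= subn0 mul1r big1 ?addr0 //.
by move=> i _; rewrite mul0r.
Qed.

Fact fps_mulDl : left_distributive fps_mul fps_add.
Proof.
move=> f g h; apply/fpsP => n /=; rewrite -big_split /=.
by apply: eq_bigr => i _; rewrite mulrDl.
Qed.

Fact fps_one_neq0 : fps_one != fps_zero.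
Proof.
apply/eqP => /fpsP/(_ 0%N) /= /eqP; apply/negP; exact: oner_neq0.
Qed.

HB.instance Definition _ := GRing.Zmodule_isComNzRing.Build (fps k)
  fps_mulA fps_mulC fps_mul1 fps_mulDl fps_one_neq0.

Fact fps_scaleA a b f : fps_scale a (fps_scale b f) = fps_scale (a * b) f.
Proof. by apply/fpsP => n /=; rewrite mulrA. Qed.
Fact fps_scale1 : left_id 1 fps_scale.
Proof. by move=> f; apply/fpsP => n /=; rewrite mul1r. Qed.
Fact fps_scaleDr : right_distributive fps_scale +%R.
Proof. by move=> a f g; apply/fpsP => n /=; rewrite mulrDr. Qed.
Fact fps_scaleDl f : {morph fps_scale^~ f : a b / a + b}.
Proof. by move=> a b; apply/fpsP => n /=; rewrite mulrDl. Qed.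

HB.instance Definition _ := GRing.Zmodule_isLmodule.Build k (fps k)
  fps_scaleA fps_scale1 fps_scaleDr fps_scaleDl.

Fact fps_scaleAl (a : k) f g : a *: (f * g) = (a *: f) * g.
Proof.
apply/fpsP => n /=; rewrite mulr_sumr.
by apply: eq_bigr => i _; rewrite mulrA.
Qed.

HB.instance Definition _ := GRing.Lmodule_isLalgebra.Build k (fps k) fps_scaleAl.
HB.instance Definition _ := GRing.Lalgebra_isComAlgebra.Build k (fps k).

Lemma coeff0 n : coeff (0 : fps k) n = 0. Proof. by []. Qed.
Lemma coeff1 n : coeff (1 : fps k) n = (n == 0%N)%:R. Proof. by []. Qed.
Lemma coeffD f g n : coeff (f + g) n = coeff f n + coeff g n. Proof. by []. Qed.
Lemma coeffN f n : coeff (- f) n = - coeff f n. Proof. by []. Qed.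
Lemma coeffB f g n : coeff (f - g) n = coeff f n - coeff g n. Proof. by []. Qed.
Lemma coeffZ c f n : coeff (c *: f) n = c * coeff f n. Proof. by []. Qed.
Lemma coeffM f g n :
  coeff (f * g) n = \sum_(i < n.+1) coeff f i * coeff g (n - i).
Proof. by []. Qed.
Lemma coeff_sum I r (P : pred I) (F : I -> fps k) n :
  coeff (\sum_(i <- r | P i) F i) n = \sum_(i <- r | P i) coeff (F i) n.
Proof. exact: (big_morph (fun f => coeff f n) (fun _ _ => erefl) erefl). Qed.

(* The inverse of a series f with f(0) != 0 is the geometric series
   f(0)^-1 * \sum_j (1 - f(0)^-1 f)^j; only j <= n contributes to t^n. *)
Definition fps_unit : pred (fps k) := [pred f | coeff f 0 != 0].

Definition fps_geom f n : fps k :=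
  \sum_(j < n.+1) (1 - (coeff f 0)^-1 *: f) ^+ j.

Definition fps_inv f : fps k :=
  if fps_unit f then
    Fps (fun n => (coeff f 0)^-1 * coeff (fps_geom f n) n)
  else f.

Let coeff_expr_lt (u : fps k) j n :
  coeff u 0 = 0 -> (n < j)%N -> coeff (u ^+ j) n = 0.
Proof.
move=> u0; elim: j n => [//|j IHj] n; rewrite ltnS => le_nj.
rewrite exprS coeffM big_ord_recl /= u0 mul0r add0r big1 // => i _.
rewrite IHj ?mulr0 // /bump /= add1n.
by apply: leq_trans le_nj; rewrite ltn_subrL /= (leq_ltn_trans _ (ltn_ord i)).
Qed.

Let coeff_geom f m n : fps_unit f -> (m <= n)%N ->
  coeff (fps_geom f n) m = coeff (fps_geom f m) m.
Proof.
move=> f0 le_mn; rewrite !coeff_sum.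
rewrite -!(big_mkord xpredT (fun j => coeff ((1 - (coeff f 0)^-1 *: f) ^+ j) m)).
rewrite (@big_cat_nat _ _ _ m.+1 0 n.+1) //= [X in _ + X]big_nat [X in _ + X]big1.
  by rewrite addr0.
move=> j /andP[lt_mj _]; apply: coeff_expr_lt lt_mj.
by rewrite coeffB coeff1 coeffZ eqxx mulVf // subrr.
Qed.

Fact fps_mulVr : {in fps_unit, left_inverse 1 fps_inv *%R}.
Proof.
move=> f f0; rewrite mulrC; apply/fpsP => n.
set a := coeff f 0; set u : fps k := 1 - a^-1 *: f.
have a0 : a != 0 by exact: f0.
transitivity (coeff ((a^-1 *: f) * fps_geom f n) n).
  rewrite !coeffM; apply: eq_bigr => -[i /=]; rewrite ltnS => le_in _.
  rewrite /fps_inv (f0 : fps_unit f = true) /= -/a (coeff_geom f0 (leq_subr i n)).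
  by rewrite mulrA [_ * a^-1]mulrC.
have -> : a^-1 *: f = 1 - u by rewrite /u opprB addrC subrK.
rewrite -[fps_geom f n]/(\sum_(j < n.+1) u ^+ j).
have -> : (1 - u) * (\sum_(j < n.+1) u ^+ j) = 1 - u ^+ n.+1.
  by rewrite -[RHS]opprB subrX1 -mulNr; congr (_ * _); rewrite [RHS]opprB.
rewrite coeffB coeff_expr_lt ?subr0 //.
by rewrite coeffB coeff1 coeffZ eqxx mulVf // subrr.
Qed.

Fact fps_unitP f g : g * f = 1 -> fps_unit f.
Proof.
move=> /fpsP/(_ 0%N); rewrite coeffM big_ord1 coeff1 eqxx => gf.
by apply/eqP => f0; move/eqP: gf; rewrite f0 mulr0 eq_sym oner_eq0.
Qed.

Fact fps_inv_out : {in [predC fps_unit], fps_inv =1 id}.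
Proof. by move=> f /negbTE f0; rewrite /fps_inv (f0 : fps_unit f = false). Qed.

HB.instance Definition _ := GRing.ComNzRing_hasMulInverse.Build (fps k)
  fps_mulVr fps_unitP fps_inv_out.

Lemma fps_neq0P f : f != 0 ->
  exists2 n, coeff f n != 0 & forall i, (i < n)%N -> coeff f i = 0.
Proof.
move=> f0; have exf : exists n, coeff f n != 0.
  apply: contrapT => H; move/eqP: f0; apply; apply/fpsP => n.
  by apply/eqP/negPn/negP => fn; apply: H; exists n.
exists (ex_minn exf); case: ex_minnP => // m fm minm i lt_im.
by apply/eqP; apply: contraTT lt_im => /minm; rewrite -leqNgt.
Qed.

Fact fps_integral : GRing.integral_domain_axiom (fps k).
Proof.
move=> f g fg0; apply/norP => -[/fps_neq0P[m fm f0] /fps_neq0P[n gn g0]].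
have : coeff f m * coeff g n != 0 by rewrite mulf_neq0.
suff -> : coeff f m * coeff g n = coeff (f * g) (m + n) by rewrite fg0 eqxx.
have lt_m : (m < (m + n).+1)%N by rewrite ltnS leq_addr.
rewrite coeffM (bigD1 (Ordinal lt_m)) //= addKn big1 ?addr0 // => i.
rewrite -val_eqE /= neq_ltn => /orP[/f0->|lt_mi]; first by rewrite mul0r.
rewrite [coeff g _]g0 ?mulr0 // ltn_subLR; first by rewrite ltn_add2r.
by rewrite -ltnS.
Qed.

HB.instance Definition _ :=
  GRing.ComUnitRing_isIntegral.Build (fps k) fps_integral.

Definition fpsX : fps k := Fps (fun n => (n == 1%N)%:R).

Definition fps_deriv f : fps k := Fps (fun n => coeff f n.+1 *+ n.+1).

End PowerSeries.

Arguments fpsX {k}.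

Notation "f %:F" := (@FracField.tofrac (fps _) f) : ring_scope.

(** k((t)) is realized as the fraction field of k[[t]]; by [laurentP] below it
    is k[[t]][1/t]. *)

Definition laurent (k : fieldType) := {fraction (fps k)}.

HB.instance Definition _ (k : fieldType) := GRing.Field.on (laurent k).

Section Laurent.
Variable k : fieldType.
Implicit Types (f g : fps k) (x y : laurent k).

Definition laurent_scale (c : k) x : laurent k := (c%:A)%:F * x.

Fact laurent_scaleA a b x :
  laurent_scale a (laurent_scale b x) = laurent_scale (a * b) x.
Proof.
by rewrite /laurent_scale mulrA -rmorphM /= -scalerAl mul1r scalerA.
Qed.
Fact laurent_scale1 : left_id 1 laurent_scale.
Proof. by move=> x; rewrite /laurent_scale scale1r rmorph1 mul1r. Qed.
Fact laurent_scaleDr : right_distributive laurent_scale +%R.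
Proof. by move=> a x y; rewrite /laurent_scale mulrDr. Qed.
Fact laurent_scaleDl x : {morph laurent_scale^~ x : a b / a + b}.
Proof. by move=> a b; rewrite /laurent_scale scalerDl rmorphD mulrDl. Qed.

HB.instance Definition _ := GRing.Zmodule_isLmodule.Build k (laurent k)
  laurent_scaleA laurent_scale1 laurent_scaleDr laurent_scaleDl.

Fact laurent_scaleAl (a : k) x y : a *: (x * y) = (a *: x) * y.
Proof. exact: mulrA. Qed.

HB.instance Definition _ :=
  GRing.Lmodule_isLalgebra.Build k (laurent k) laurent_scaleAl.
HB.instance Definition _ :=
  GRing.Lalgebra_isComAlgebra.Build k (laurent k).

Lemma laurent_scaleE (c : k) f : c *: (f%:F : laurent k) = (c *: f)%:F.
Proof. by rewrite -[LHS]rmorphM /= -scalerAl mul1r. Qed.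

Lemma fpsX_neq0 : fpsX != 0 :> fps k.
Proof. by apply/eqP => /fpsP/(_ 1%N) /eqP; rewrite oner_eq0. Qed.

Lemma coeff_mulXn f n i :
  coeff (f * fpsX ^+ n) i = if (i < n)%N then 0 else coeff f (i - n).
Proof.
elim: n i => [|n IHn] i; first by rewrite expr0 mulr1 subn0.
have mulX h j : coeff (h * fpsX) j = if j is j'.+1 then coeff h j' else 0.
  rewrite mulrC coeffM big_ord_recl /= mul0r add0r.
  case: j => [|j]; first by rewrite big_ord0.
  rewrite big_ord_recl /= mul1r /bump /= add1n subSS subn0 big1 ?addr0 //.
  by move=> l _; rewrite mul0r.
by rewrite exprSr mulrA mulX; case: i => [//|i]; rewrite IHn.
Qed.

Lemma fps_factor f : f != 0 ->
  exists n u, u \is a GRing.unit /\ f = u * fpsX ^+ n.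
Proof.
case/fps_neq0P => n fn f0; exists n, (Fps (fun i => coeff f (i + n))); split.
  exact: fn.
by apply/fpsP => i; rewrite coeff_mulXn /=; case: ltnP => [/f0|/subnK->].
Qed.

Lemma laurentP x : exists f n, x = f%:F / fpsX%:F ^+ n.
Proof.
have [p [q [q0 eq_x]]] : exists p q, q != 0 /\ x * q%:F = p%:F.
  elim/quotW: x => r; exists (frac r).1, (frac r).2; split.
    exact: denom_ratioP.
  unlock FracField.tofrac; rewrite -[LHS]FracField.pi_mul; apply/eqmodP.
  rewrite /= FracField.equivfE /FracField.mulf.
  rewrite !numden_Ratio ?(oner_eq0, mulf_neq0, denom_ratioP) //.
  by rewrite !mulr1 mulrC.
have [n [u [uU eq_q]]] := fps_factor q0.
exists (p * u^-1), n; apply: (mulIf (x := q%:F)); first by rewrite tofrac_eq0.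
rewrite eq_x [in RHS]eq_q !rmorphM rmorphXn /= [u%:F * _]mulrC mulrA.
rewrite mulfVK ?expf_neq0 ?tofrac_eq0 ?fpsX_neq0 //.
by rewrite -!rmorphM /= mulrVK.
Qed.

End Laurent.

(* [{pred K}] is boolean, but classically (boolp) it ranges over all subsets
   of K; [divring_closed] subsets of a field are its subfields as 0^-1 = 0. *)

Definition subfield_gen (K : fieldType) (A : K -> Prop) : {pred K} :=
  [pred x | `[< forall S : {pred K}, divring_closed S ->
                  (forall a, A a -> a \in S) -> x \in S >] ].

Lemma subfield_gen_sub (K : fieldType) (A : K -> Prop) a :
  A a -> a \in subfield_gen A.
Proof. by move=> Aa; apply/asboolP => S _; apply. Qed.

Lemma subfield_gen_closed (K : fieldType) (A : K -> Prop) :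
  divring_closed (subfield_gen A).
Proof.
split=> [|x y /asboolP Ax /asboolP Ay|x y /asboolP Ax /asboolP Ay];
  apply/asboolP => S Sdiv AS; case: (Sdiv) => S1 SB SV => //.
- by apply: SB; [apply: Ax|apply: Ay].
- by apply: SV; [apply: Ax|apply: Ay].
Qed.

HB.instance Definition _ (K : fieldType) (A : K -> Prop) :=
  GRing.isDivringClosed.Build K (subfield_gen A) (subfield_gen_closed A).

Section Vg.
Variables (k : fieldType) (g : fps k).

Definition ktg_gens (x : laurent k) : Prop :=
  [\/ exists c : k, x = c%:A, x = fpsX%:F | x = g%:F].

Definition ktg : {pred laurent k} := subfield_gen ktg_gens.

HB.instance Definition _ := GRing.DivringClosed.on ktg.

Definition in_fps : {pred laurent k} := [pred x | `[< exists f, x = f%:F >] ].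

Definition Vg_pred : {pred laurent k} := [predI ktg & in_fps].

Fact Vg_subalg_closed : subalg_closed Vg_pred.
Proof.
split.
- by rewrite inE rpred1; apply/asboolP; exists 1; rewrite rmorph1.
- move=> c x y /andP[Kx /asboolP[f xf]] /andP[Ky /asboolP[h yh]].
  rewrite inE; apply/andP; split; last first.
    by apply/asboolP; exists (c *: f + h); rewrite rmorphD xf yh laurent_scaleE.
  rewrite rpredD // -mulr_algl rpredM //.
  by apply: subfield_gen_sub; constructor 1; exists c.
- move=> x y /andP[Kx /asboolP[f xf]] /andP[Ky /asboolP[h yh]].
  rewrite inE rpredM //=; apply/asboolP; exists (f * h).
  by rewrite rmorphM xf yh.
Qed.

HB.instance Definition _ :=
  GRing.isSubalgClosed.Build k (laurent k) Vg_pred Vg_subalg_closed.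

Record Vg := MkVg { Vg_val : laurent k; Vg_valP : Vg_val \in Vg_pred }.

HB.instance Definition _ := [isSub for Vg_val].
HB.instance Definition _ := [Choice of Vg by <:].
HB.instance Definition _ := [SubChoice_isSubComNzRing of Vg by <:].
HB.instance Definition _ := [SubZmodule_isSubLmodule of Vg by <:].
HB.instance Definition _ := [SubNzRing_SubLmodule_isSubLalgebra of Vg by <:].
HB.instance Definition _ := [SubLalgebra_isSubAlgebra of Vg by <:].

Fact ktg_X : fpsX%:F \in ktg.
Proof. by apply: subfield_gen_sub; constructor 2. Qed.

Fact Vg_X_subproof : fpsX%:F \in Vg_pred.
Proof. by rewrite inE ktg_X; apply/asboolP; exists fpsX. Qed.

Definition Vg_X : Vg := MkVg Vg_X_subproof.

(* V_g is a discrete valuation ring with uniformizer t. *)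
Lemma Vg_dvr :
  (forall v : Vg, Vg_X * v != 1) /\
  (forall x : Vg, x != 0 ->
     exists n (u v : Vg), u * v = 1 /\ x = u * Vg_X ^+ n).
Proof.
split=> [[v vV]|].
  have /andP[_ /asboolP[f vf]] := vV.
  apply/eqP => /(congr1 val); rewrite rmorphM rmorph1 /= vf -rmorphM => /eqP.
  rewrite -[1](rmorph1 (@FracField.tofrac (fps k))) tofrac_eq => /eqP /fpsP /(_ 0%N) /eqP.
  by rewrite coeffM big_ord1 mul0r eq_sym oner_eq0.
move=> [x xV] x0; have /andP[Kx /asboolP[f xf]] := xV.
have f0 : f != 0.
  apply: contraNneq x0 => f_0; apply/eqP/val_inj.
  by rewrite [RHS]rmorph0 /= xf f_0 rmorph0.
have [n [u [uU fE]]] := fps_factor f0.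
have XF0 : fpsX%:F ^+ n != 0 :> laurent k.
  by rewrite expf_neq0 // tofrac_eq0 fpsX_neq0.
have uE : u%:F = x / fpsX%:F ^+ n.
  by rewrite xf fE rmorphM rmorphXn mulfK.
have Ku : u%:F \in ktg by rewrite uE rpred_div // rpredX // ktg_X.
have uV : u%:F \in Vg_pred by rewrite inE Ku; apply/asboolP; exists u.
have u'E : (u^-1)%:F = (u%:F)^-1 :> laurent k by rewrite rmorphV.
have vV : (u^-1)%:F \in Vg_pred.
  by rewrite inE u'E rpredV Ku -u'E; apply/asboolP; exists u^-1.
exists n, (MkVg uV), (MkVg vV); split; apply: val_inj.
  by rewrite rmorphM rmorph1 /= -rmorphM mulrV // rmorph1.
by rewrite rmorphM rmorphXn /= uE divfK.
Qed.

End Vg.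

(* k-linearity is carried by the type {linear _ -> _}. *)
Definition is_derivation (k : fieldType) (A : comAlgType k)
    (D : {linear A -> A}) : Prop :=
  forall a b : A, D (a * b) = a * D b + b * D a.

(* Main.v *)
Require Import Defs.
From mathcomp Require Import all_boot all_order all_algebra.
From mathcomp Require Import boolp.

Import GRing.Theory.
Local Open Scope ring_scope.

Set Implicit Arguments.
Unset Strict Implicit.
Unset Printing Implicit Defensive.

(** Let D be a k-derivation of V_g.  Then x |-> D x - x' * D t is a k-derivation
    from V_g to k[[t]] that kills t, hence maps c + t y to t times its value at
    y.  As every element of V_g has the form c + t y with y in V_g, its values
    are divisible by every power of t, so D x = x' * D t.  For x = g this gives
    g' = D g / D t in k(t,g), unless D t = 0, in which case D = 0. *)

Lemma coeff_Xmul (k : fieldType) (f : fps k) n :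
  coeff (fpsX * f) n = if n is m.+1 then coeff f m else 0.
Proof.
by rewrite mulrC -[fpsX]expr1 coeff_mulXn; case: n => // n; rewrite subSS subn0.
Qed.

Lemma fps_decomp (k : fieldType) (f : fps k) :
  exists h : fps k, f = (coeff f 0)%:A + fpsX * h.
Proof.
exists (Fps (fun n => coeff f n.+1)); apply/fpsP => n.
rewrite coeffD coeff_Xmul coeffZ coeff1.
by case: n => [|n]; rewrite ?mulr1 ?addr0 // mulr0 add0r.
Qed.

Lemma fps_deriv_decomp (k : fieldType) (c : k) (f : fps k) :
  fps_deriv (c%:A + fpsX * f) = f + fpsX * fps_deriv f.
Proof.
apply/fpsP => n; rewrite -[LHS]/(coeff (_ + _) n.+1 *+ n.+1) !coeffD !coeff_Xmul coeffZ coeff1 mulr0 add0r.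
by case: n => [|n]; rewrite ?addr0 // mulrS.
Qed.

Section VgDerivation.
Variables (k : fieldType) (g : fps k).

Lemma Vg_series (x : Vg g) : exists f, val x = f%:F.
Proof. by case: x => x /= /andP[_ /asboolP]. Qed.

Lemma Vg_ktg (x : Vg g) : val x \in ktg g.
Proof. by case: x => x /= /andP[]. Qed.

(** The quotient [(x - c) / t] stays in the field [k(t,g)], and it is the power series [f], so it
    lies in [V_g]. *)
Lemma Vg_decomp (x : Vg g) (c : k) (f : fps k) :
  val x = (c%:A + fpsX * f)%:F ->
  exists2 y : Vg g, val y = f%:F & x = c%:A + Vg_X g * y.
Proof.
move=> xE.
have fE : f%:F = (val x - val (c%:A : Vg g)) / fpsX%:F :> laurent k.
  rewrite xE rmorphD rmorphM /= -laurent_scaleE rmorph1 addrAC subrr add0r.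
  by rewrite mulrC mulKf // tofrac_eq0 fpsX_neq0.
have fV : f%:F \in Vg_pred g.
  rewrite inE {1}fE rpred_div ?rpredB ?Vg_ktg ?ktg_X //.
  by apply/asboolP; exists f.
exists (MkVg fV) => //; apply: val_inj.
by rewrite xE rmorphD rmorphM /= -laurent_scaleE rmorph1.
Qed.

Variable D : {linear Vg g -> Vg g}.
Hypothesis D_der : is_derivation D.

Lemma derivation_const (c : k) : D c%:A = 0.
Proof.
(* The Leibniz rule for [1 * 1] reads [D 1 = D 1 + D 1], so [D 1 = 0] in every characteristic. *)
have /eqP := D_der 1 1.
by rewrite !mul1r -subr_eq0 opprD addNKr oppr_eq0 linearZ => /eqP->; exact: scaler0.
Qed.

Lemma derivation_coeff n (x : Vg g) (f h d : fps k) :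
  val x = f%:F -> val (D x) = h%:F -> val (D (Vg_X g)) = d%:F ->
  coeff h n = coeff (fps_deriv f * d) n.
Proof.
(* [x], [f] and [h] vary because the induction passes from [x] to [y]; [d] stays fixed. *)
move=> xf Dxh Dtd; elim: n x f h xf Dxh => [|n IHn] x f h xf Dxh.
all: have [f1 fE] := fps_decomp f.
all: rewrite fE in xf; have [y yf1 xE] := Vg_decomp xf.
all: have [h1 Dyh1] := Vg_series (D y).
(* The Leibniz rule on [x = c + t y] gives [D x = t D y + y D t]. *)
all: have hE : h = fpsX * h1 + f1 * d
  by apply/eqP; rewrite -tofrac_eq -Dxh xE linearD derivation_const add0r D_der
       !rmorphD !rmorphM /= Dyh1 Dtd yf1.
(* Since [f' = f1 + t f1'], both sides share [f1 * d]. The remaining terms are multiples of [t]: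
   their constant coefficients vanish, and coefficient [n.+1] is coefficient [n] of the claim for
   [y]. *)
all: rewrite fE fps_deriv_decomp hE mulrDl -mulrA coeffD [RHS]coeffD addrC.
all: congr (_ + _); rewrite !coeff_Xmul //.
exact: IHn yf1 Dyh1.
Qed.

Lemma derivation_chain (x : Vg g) (f : fps k) : val x = f%:F ->
  val (D x) = (fps_deriv f)%:F * val (D (Vg_X g)).
Proof.
move=> xf; have [h Dxh] := Vg_series (D x).
have [d Dtd] := Vg_series (D (Vg_X g)).
rewrite Dxh Dtd -rmorphM; congr (_%:F); apply/fpsP => n.
exact: derivation_coeff xf Dxh Dtd.
Qed.

End VgDerivation.

Theorem corollary4p5 (k : fieldType) (g : fps k)
    (g0 : coeff g 0 = 0) (dg : (fps_deriv g)%:F \notin ktg g)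
    (D : {linear Vg g -> Vg g}) (D_der : is_derivation D) :
  forall x : Vg g, D x = 0.
Proof.
have gV : g%:F \in Vg_pred g.
  rewrite inE; apply/andP; split; last by apply/asboolP; exists g.
  by apply: subfield_gen_sub; constructor 3.
have Dt0 : val (D (Vg_X g)) = 0.
  apply/eqP; apply: contraNT dg => Dt0.
  (* [D t] may be a non-unit of [V_g], so the division [g' = D g / D t] takes place in the field
     [k(t,g)]. *)
  have /(canRL (mulfK Dt0)) -> := esym (derivation_chain D_der (x := MkVg gV) erefl).
  by rewrite rpred_div ?Vg_ktg.
move=> x; have [f xf] := Vg_series x.
by apply: val_inj; rewrite (derivation_chain D_der xf) Dt0 mulr0 rmorph0.
Qed.
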